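(* Let $n \ge 1$. With $\mathcal{S}_n^+$, $\mathcal{N}_n$, $\mathcal{G}_n$, $\widehat{\mathcal{G}_n}$ and $\mathrm{com}(\mathcal{S}_n^+,\mathcal{N}_n)$ as defined in the context, the following hold. (i) $\mathcal{S}_n^+ \cup \mathcal{N}_n \subseteq \mathcal{G}_n$. (ii) $\mathcal{G}_n = \mathrm{com}(\mathcal{S}_n^+, \mathcal{N}_n)$. (iii) $\mathrm{conv}(\mathcal{S}_n^+ \cup \mathcal{N}_n) = \mathcal{S}_n^+ + \mathcal{N}_n$. (iv) $\mathcal{S}_n^+ \cup \mathcal{N}_n \subseteq \mathcal{G}_n = \mathrm{com}(\mathcal{S}_n^+, \mathcal{N}_n) \subseteq \widehat{\mathcal{G}_n} \subseteq \mathcal{S}_n^+ + \mathcal{N}_n$. (v) If $n = 2$, then $\mathcal{S}_n^+ \cup \mathcal{N}_n = \mathcal{G}_n = \mathrm{com}(\mathcal{S}_n^+, \mathcal{N}_n) = \widehat{\mathcal{G}_n} = \mathcal{S}_n^+ + \mathcal{N}_n$. (vi) $\mathrm{conv}(\mathcal{S}_n^+ \cup \mathcal{N}_n) = \mathrm{conv}(\mathcal{G}_n) = \mathrm{conv}\left(\mathrm{com}(\mathcal{S}_n^+, \mathcal{N}_n)\right) = \mathrm{conv}(\widehat{\mathcal{G}_n}) = \mathcal{S}_n^+ + \mathcal{N}_n$.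
   Context: $\mathcal{S}_n$ is the space of real symmetric $n\times n$ matrices; $\mathcal{S}_n^+\subseteq\mathcal{S}_n$ is the cone of positive semidefinite matrices; $\mathcal{N}_n\subseteq\mathcal{S}_n$ is the cone of symmetric matrices with all entries nonnegative; $\mathcal{S}_n^+ + \mathcal{N}_n$ is their Minkowski sum; $\mathrm{conv}$ denotes convex hull. $\mathcal{O}_n$ is the set of $n\times n$ real orthogonal matrices and $\mathcal{D}_n$ the set of $n\times n$ real diagonal matrices. For $P=[p_1,\dots,p_n]\in\mathbb{R}^{n\times n}$ (columns $p_k$) and $\Lambda=\mathrm{Diag}(\lambda_1,\dots,\lambda_n)\in\mathcal{D}_n$, let $\alpha_*(P,\Lambda)$ be the optimal value of the linear program in the variables $\omega_1,\dots,\omega_n,\alpha\in\mathbb{R}$: maximize $\alpha$ subject to $\omega_i\le\lambda_i$ $(i=1,\dots,n)$ and $\left[\sum_{k=1}^n\omega_k p_kp_k^T\right]_{ij}\ge\alpha$ $(1\le i\le j\le n)$. (This program has an optimal solution.) Define $\mathcal{G}_n := \{A\in\mathcal{S}_n \mid \text{there is } (P,\Lambda)\in\mathcal{O}_n\times\mathcal{D}_n \text{ with } A=P\Lambda P^T \text{ and } \alpha_*(P,\Lambda)\ge 0\}$, $\widehat{\mathcal{G}_n} := \{A\in\mathcal{S}_n \mid \text{there is } (P,\Lambda)\in\mathbb{R}^{n\times n}\times\mathcal{D}_n \text{ with } A=P\Lambda P^T \text{ and } \alpha_*(P,\Lambda)\ge 0\}$, $\mathrm{com}(\mathcal{S}_n^+,\mathcal{N}_n)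 := \{S+N \mid S\in\mathcal{S}_n^+,\ N\in\mathcal{N}_n,\ SN=NS\}$. *)

(* Defs.v *)
From HB Require Import structures.
From mathcomp Require Import all_boot all_order all_algebra.
From mathcomp Require Import all_classical all_reals all_analysis.

Set Implicit Arguments.
Unset Strict Implicit.
Unset Printing Implicit Defensive.
Import Order.TTheory GRing.Theory Num.Theory.
Local Open Scope classical_set_scope.
Local Open Scope ring_scope.

Section Cones.
Variables (R : realType) (n : nat).
Implicit Types (A P S N Lambda : 'M[R]_n).

Definition symmetric_matrices : set 'M[R]_n := [set A | A \is symmetricmx].

Definition psd_cone : set 'M[R]_n :=
  [set A | A \is symmetricmx /\ forall x : 'cV[R]_n, 0 <= (x^T *m A *m x) 0 0].

Definition nonneg_cone : set 'M[R]_n :=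
  [set A | A \is symmetricmx /\ forall i j, 0 <= A i j].

Definition orthogonal_matrices : set 'M[R]_n := [set P | P *m P^T = 1%:M].

Definition diagonal_matrices : set 'M[R]_n := [set D | is_diag_mx D].

Definition minkowski_sum (X Y : set 'M[R]_n) : set 'M[R]_n :=
  [set x + y | x in X & y in Y].

Definition conv_hull (X : set 'M[R]_n) : set 'M[R]_n :=
  smallest (@convex_set R 'M[R]_n) X.

Definition lp_feasible P Lambda (omega : 'I_n -> R) (alpha : R) : Prop :=
  (forall i, omega i <= Lambda i i) /\
  (forall i j : 'I_n, (i <= j)%N ->
     alpha <= (\sum_(k < n) omega k *: (col k P *m (col k P)^T)) i j).

(* The optimal value is taken in the extended reals so that no default value
   can interfere: when 0 < n the program is feasible and bounded above, and
   this is the real number attained by an optimal solution. *)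
Definition alpha_star P Lambda : \bar R :=
  ereal_sup [set alpha%:E | alpha in
    [set alpha | exists omega, lp_feasible P Lambda omega alpha]].

Definition Gset : set 'M[R]_n :=
  [set A | symmetric_matrices A /\
     exists P Lambda, [/\ orthogonal_matrices P, diagonal_matrices Lambda,
       A = P *m Lambda *m P^T & (0 <= alpha_star P Lambda)%E]].

Definition Ghat : set 'M[R]_n :=
  [set A | symmetric_matrices A /\
     exists P Lambda, [/\ diagonal_matrices Lambda,
       A = P *m Lambda *m P^T & (0 <= alpha_star P Lambda)%E]].

Definition com_sum : set 'M[R]_n :=
  [set A | exists S N, [/\ psd_cone S, nonneg_cone N, S *m N = N *m S
                         & A = S + N]].

End Cones.

Arguments psd_cone R n : clear implicits.
Arguments nonneg_cone R n : clear implicits.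
Arguments Gset R n : clear implicits.
Arguments Ghat R n : clear implicits.
Arguments com_sum R n : clear implicits.

(* Main.v *)
(* Commuting symmetric matrices S and N have a common
   orthonormal eigenbasis P, so writing S = P Diag(d) P^T and
   N = P Diag(w) P^T, the membership of S in the PSD cone says d >= 0, while
   w is feasible for the linear program of (P, Diag(d + w)) at level 0 exactly
   when N is entrywise nonnegative. Conversely an optimal w splits P L P^T into
   a PSD part P (L - Diag(w)) P^T and a nonnegative part P Diag(w) P^T, which
   commute when P is orthogonal. The convex hulls are squeezed between the
   hull of the union and the convex cone S^+ + N. *)

Require Import Defs.
From HB Require Import structures.
From mathcomp Require Import all_boot all_order all_algebra.
From mathcomp Require Import all_classical all_reals all_analysis.
From mathcomp Require Import ring lra.
Import Order.TTheory GRing.Theory Num.Theory numFieldNormedType.Exports.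
Local Open Scope classical_set_scope.
Local Open Scope ring_scope.

(** * Inner product of row vectors and eigenvectors of symmetric matrices *)

Lemma continuous_sum (R : realType) (T : topologicalType) (I : finType)
    (F : I -> T -> R) :
  (forall i, continuous (F i)) -> continuous (fun x => \sum_i F i x).
Proof.
move=> cF; rewrite (_ : (fun x => _) = \sum_i F i); last first.
  by apply/funext => x; rewrite fct_sumE.
apply: (big_ind (fun g : T -> R => continuous g)) => //.
- by move=> x; exact: cvg_cst.
- by move=> f g cf cg x; apply: continuousD; [exact: cf|exact: cg].
Qed.

Section RowDot.
Context {R : realType} {n : nat}.
Implicit Types (x y z : 'rV[R]_n) (A : 'M[R]_n).

Definition dot x y : R := (x *m y^T) 0 0.

Lemma dotE x y : dot x y = \sum_i x 0 i * y 0 i.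
Proof. by rewrite /dot mxE; apply: eq_bigr => i _; rewrite mxE. Qed.

Lemma dotC x y : dot x y = dot y x.
Proof. by rewrite !dotE; apply: eq_bigr => i _; rewrite mulrC. Qed.

Lemma dotDl x y z : dot (x + y) z = dot x z + dot y z.
Proof. by rewrite /dot mulmxDl mxE. Qed.

Lemma dotZl a x y : dot (a *: x) y = a * dot x y.
Proof. by rewrite /dot -scalemxAl mxE. Qed.

Lemma dotDr x y z : dot z (x + y) = dot z x + dot z y.
Proof. by rewrite dotC dotDl !(dotC z). Qed.

Lemma dotZr a x y : dot x (a *: y) = a * dot x y.
Proof. by rewrite dotC dotZl dotC. Qed.

Lemma dot_ge0 x : 0 <= dot x x.
Proof. by rewrite dotE sumr_ge0 // => i _; rewrite -expr2 sqr_ge0. Qed.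

Lemma dot_eq0 x : (dot x x == 0) = (x == 0).
Proof.
apply/eqP/eqP => [|->]; last by rewrite /dot mul0mx mxE.
rewrite dotE => /psumr_eq0P x0; apply/rowP => i; rewrite mxE.
have /(_ i isT)/eqP := x0 (fun i _ => sqr_ge0 (x 0 i)).
by rewrite mulf_eq0 orbb => /eqP.
Qed.

Lemma dot_delta x i : dot x (delta_mx 0 i) = x 0 i.
Proof.
rewrite dotE (bigD1 i) //= big1 => [|j ji]; rewrite mxE !eqxx.
  by rewrite mulr1 addr0.
by rewrite (negPf ji) mulr0.
Qed.

Lemma dot_sym A x y : A^T = A -> dot (x *m A) y = dot x (y *m A).
Proof. by move=> AT; rewrite /dot trmx_mul AT mulmxA. Qed.

Lemma dot_mulmx_continuous A : continuous (fun x => dot (x *m A) x).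
Proof.
rewrite (_ : (fun x => _) =
    fun x => \sum_j (\sum_i x 0 i * A i j) * x 0 j); last first.
  by apply/funext => x; rewrite dotE; apply: eq_bigr => j _; rewrite mxE.
apply: continuous_sum => j x; apply: continuousM; last exact: coord_continuous.
move: x; apply: continuous_sum => i x.
apply: (@continuousM _ _ _ (fun=> A i j)); last exact: cst_continuous.
exact: coord_continuous.
Qed.

(** The set is closed in the cube [-1, 1]^n. The matrix [K] encodes a linear subspace as its left
    kernel, so that a maximisation can be restricted to that subspace. *)
Lemma unit_sphere_compact m (K : 'M[R]_(n, m)) :
  compact [set x : 'rV[R]_n | dot x x = 1 /\ x *m K = 0].
Proof.
pose B : set 'rV[R]_n := [set x | forall i, `[-1, 1]%classic (x 0 i)].
apply: (@subclosed_compact _ _ B).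
(* The factor [1%:M] makes the squared norm an instance of the quadratic form already known to be
   continuous. *)
- rewrite (_ : [set x | _] = [set x | dot (x *m 1%:M) x = 1] `&`
      \bigcap_(j in [set: 'I_m]) [set x | \sum_i x 0 i * K i j = 0]).
    apply: closedI.
      apply: (@closed_comp _ _ (fun x => dot (x *m 1%:M) x) [set 1]).
        by move=> x _; exact: dot_mulmx_continuous.
      exact: closed_eq.
    apply: closed_bigI => j _.
    apply: (@closed_comp _ _
        (fun x : 'rV[R]_n => \sum_i x 0 i * K i j) [set 0]).
      move=> x _; move: x; apply: continuous_sum => i x.
      apply: (@continuousM _ _ _ (fun=> K i j)); last exact: cst_continuous.
      exact: coord_continuous.
    exact: closed_eq.
  apply/seteqP; split=> x /=; rewrite mulmx1.
    by move=> [-> xK]; split=> // j _; move/rowP/(_ j): xK; rewrite !mxE.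
  move=> [-> xK]; split=> //; apply/rowP => j; rewrite !mxE.
  exact: xK.
- rewrite /B; apply: (@rV_compact R n (fun=> `[-1, 1]%classic)) => _.
  exact: segment_compact.
- move=> x [x1 _] i /=; rewrite in_itv /= -ler_norml.
  rewrite -(@expr_le1 _ 2) // -normrX ger0_norm ?sqr_ge0 // -x1 dotE.
  rewrite (bigD1 i) //= -expr2 lerDl sumr_ge0 // => j _.
  by rewrite -expr2 sqr_ge0.
Qed.

(* A maximiser [c] of the Rayleigh quotient on the invariant subspace
   [x *m K = 0] is an eigenvector: with [w] the component of [c *m A]
   orthogonal to [c], the quotient would increase in the direction [w]. *)
Lemma symmetric_eigenvector m A (K : 'M[R]_(n, m)) :
  A^T = A -> (forall x, x *m K = 0 -> x *m A *m K = 0) ->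
  (exists2 x : 'rV[R]_n, x != 0 & x *m K = 0) ->
  exists c l, [/\ dot c c = 1, c *m K = 0 & c *m A = l *: c].
Proof.
move=> AT AK [x0 x0N0 x0K].
have unitize x : x != 0 -> x *m K = 0 ->
    exists2 a, 0 < a & dot (a *: x) (a *: x) = 1 /\ (a *: x) *m K = 0.
  move=> xN0 xK; have xx : 0 < dot x x by rewrite lt0r dot_eq0 xN0 dot_ge0.
  exists (Num.sqrt (dot x x))^-1; first by rewrite invr_gt0 sqrtr_gt0.
  split; last by rewrite -scalemxAl xK scaler0.
  rewrite dotZl dotZr mulrA -invfM -expr2 sqr_sqrtr ?mulVf ?dot_ge0 //.
  by rewrite gt_eqF.
have [c /[!inE] -[c1 cK] cmax] : exists2 c,
    c \in [set x : 'rV[R]_n | dot x x = 1 /\ x *m K = 0] &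
    forall x, x \in [set x : 'rV[R]_n | dot x x = 1 /\ x *m K = 0] ->
      dot (x *m A) x <= dot (c *m A) c.
  apply: compact_EVT_max; last first.
  - by apply: continuous_subspaceT; exact: dot_mulmx_continuous.
  - exact: unit_sphere_compact.
  - by have [a _ xP] := unitize _ x0N0 x0K; exists (a *: x0).
set l := dot (c *m A) c in cmax.
(* By homogeneity the bound passes from unit vectors to the whole subspace. *)
have le_l x : x *m K = 0 -> dot (x *m A) x <= l * dot x x.
  move=> xK; have [->|xN0] := eqVneq x 0.
    by rewrite /dot !mul0mx mxE mulr0.
  have [a a0 xP] := unitize _ xN0 xK.
  have := cmax (a *: x); rewrite inE => /(_ xP).
  rewrite -scalemxAl dotZl dotZr mulrA => /(ler_wpM2r (dot_ge0 x)).
  case: xP; rewrite dotZl dotZr mulrA => ax1 _.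
  by rewrite mulrAC ax1 mul1r.
have [w [wK cAE wc]] :
    exists w, [/\ w *m K = 0, c *m A = w + l *: c & dot w c = 0].
  exists (c *m A - l *: c); split; last 1 first.
  - by rewrite -scaleNr dotDl dotZl c1 -/l mulr1 subrr.
  - by rewrite mulmxBl AK // -scalemxAl cK scaler0 subrr.
  - by rewrite subrK.
exists c, l; split=> //; apply/eqP; rewrite cAE -subr_eq0 addrK -dot_eq0.
have := le_l w wK.
set q := dot (w *m A) w; set s := dot w w => qs.
have s0 : 0 <= s := dot_ge0 w.
(* The bound at [c + t *: w] reads [2 t s <= t^2 (l s - q)]. This [t] turns the right side into
   [t s - t^2], which forces [t = 0] and then [s = 0]; the added 1 keeps the denominator
   positive. *)
pose t := s / (1 + (l * s - q)).
have tK : (c + t *: w) *m K = 0.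
  by rewrite mulmxDl -scalemxAl cK wK scaler0 addr0.
have := le_l _ tK; rewrite mulmxDl -scalemxAl.
rewrite !(dotDl, dotDr, dotZl, dotZr) -/q -/s -/l (dotC c w) wc c1.
rewrite (dot_sym _ _ _ AT) {1}(dotC w) cAE.
rewrite !(dotDl, dotDr, dotZl, dotZr) -/s (dotC c w) wc.
have r0 : 0 < 1 + (l * s - q) by lra.
have ts : t * (1 + (l * s - q)) = s by rewrite /t divfK // gt_eqF.
have t0 : 0 <= t by rewrite /t divr_ge0 // ltW.
have ttE : t * t * (l * s - q) = t * s - t * t.
  by have /= := congr1 ( *%R t) ts; lra.
have tt0 : 0 <= t * t := mulr_ge0 t0 t0; have ts0 := mulr_ge0 t0 s0.
move=> H; have : t * t == 0 by rewrite eq_le tt0 andbT; lra.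
by rewrite mulf_eq0 orbb -ts => /eqP ->; rewrite mul0r.
Qed.

(** An eigenspace of [A] is the left kernel of [A - a%:M], and commutation makes it invariant under
    [B]; an eigenvector of [B] is then sought inside it. *)
Lemma common_eigenvector_symmetric A B :
  (0 < n)%N -> A^T = A -> B^T = B -> A *m B = B *m A ->
  exists c a b, [/\ dot c c = 1, c *m A = a *: c & c *m B = b *: c].
Proof.
move=> n0 AT BT AB.
(* With [K = 0] the subspace is the whole space. *)
have [||x [a [x1 _ xA]]] := @symmetric_eigenvector n A 0 AT.
- by move=> x _; rewrite mulmx0.
- exists (const_mx 1); last by rewrite mulmx0.
  apply/eqP => /rowP/(_ (Ordinal n0)); rewrite !mxE.
  exact/eqP/oner_neq0.
have [||c [b [c1 /eqP cA cB]]] := @symmetric_eigenvector n B (A - a%:M) BT.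
- move=> y /eqP; rewrite mulmxBr mul_mx_scalar subr_eq0 => /eqP yA.
  rewrite mulmxBr -mulmxA -AB mulmxA yA mul_mx_scalar -scalemxAl subrr //.
- exists x; first by rewrite -dot_eq0 x1 oner_eq0.
  by rewrite mulmxBr mul_mx_scalar xA subrr.
exists c, a, b; split=> //.
by move: cA; rewrite mulmxBr mul_mx_scalar subr_eq0 => /eqP.
Qed.

End RowDot.

(** * Simultaneous orthogonal diagonalization of commuting symmetric matrices *)

(** [H] is the Householder reflection along [v = x - e], which sends the basis vector [e] to [x];
    when [x = e] the identity is taken instead. *)
Lemma reflection_to_unit (R : realType) (n : nat) (x : 'rV[R]_n) (i0 : 'I_n) :
  dot x x = 1 ->
  exists H : 'M[R]_n, [/\ H^T = H, H *m H = 1%:M & row i0 H = x].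
Proof.
move=> x1; pose e : 'rV[R]_n := delta_mx 0 i0; pose v := x - e.
have ev : dot e v = x 0 i0 - 1.
  by rewrite dotC dot_delta !mxE !eqxx.
have vv : dot v v = 2 - 2 * x 0 i0.
  rewrite {1}/v -scaleN1r dotDl dotZl ev /v -scaleN1r dotDr dotZr x1 dot_delta.
  by ring.
have [v0|vN0] := eqVneq v 0.
  exists 1%:M; split; rewrite ?trmx1 ?mulmx1 // rowE mulmx1.
  by apply/esym/eqP; rewrite -subr_eq0 -/v v0.
have k0 : dot v v != 0 by rewrite dot_eq0.
pose k := 2 / dot v v; pose V := v^T *m v.
have VV : V *m V = dot v v *: V.
  rewrite /V mulmxA -(mulmxA v^T) [v *m v^T]mx11_scalar.
  by rewrite mul_mx_scalar scalemxAl.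
exists (1%:M - k *: V); split.
- by rewrite linearB /= trmx1 linearZ /= trmx_mul trmxK.
- rewrite mulmxBl mul1mx mulmxBr mulmx1 -scalemxAl -scalemxAr VV !scalerA.
  have -> : k * k * dot v v = k + k by rewrite /k; field.
  by rewrite scalerDl opprB addrK subrK.
- rewrite rowE mulmxBr mulmx1 -scalemxAr mulmxA.
  rewrite [delta_mx 0 i0 *m v^T]mx11_scalar mul_scalar_mx -/(dot e v).
  rewrite ev scalerA.
  have -> : k * (x 0 i0 - 1) = -1.
    by move: k0; rewrite /k vv => k0; field.
  by rewrite scaleN1r opprK addrC /v subrK.
Qed.

(** Induction on the order: a reflection whose first row is a common unit eigenvector splits a 1 by
    1 block off both matrices. *)
Lemma symmetric_codiagonalizable (R : realType) (n : nat) (A B : 'M[R]_n) :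
  A^T = A -> B^T = B -> A *m B = B *m A ->
  exists P (a b : 'rV[R]_n), [/\ P *m P^T = 1%:M,
    A = P *m diag_mx a *m P^T & B = P *m diag_mx b *m P^T].
Proof.
elim: n A B => [|n IHn] A B AT BT AB.
  exists 1%:M, 0, 0; split; by apply/matrixP => -[].
have [//|c [a [b [c1 cA cB]]]] := common_eigenvector_symmetric A B _ AT BT AB.
have [H [HT HH Hc]] := reflection_to_unit _ _ _ ord0 c1.
(* The eigenvector equation fixes the first row of [H *m M *m H]; symmetry then clears the first
   column. *)
have deflate (M : 'M[R]_(1 + n)) l : M^T = M -> c *m M = l *: c ->
    exists2 D : 'M[R]_n, D^T = D &
      H *m M *m H = block_mx (l%:M : 'M[R]_1) 0 0 D.
  move=> MT cM; pose M' : 'M[R]_(1 + n) := H *m M *m H.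
  have M'T : M'^T = M' by rewrite /M' !trmx_mul HT MT mulmxA.
  have row0 : row 0 M' = l *: row 0 1%:M.
    by rewrite /M' !row_mul Hc cM -scalemxAl -Hc -row_mul HH.
  have u0 : ursubmx M' = 0.
    apply/matrixP => i j; have /rowP/(_ (rshift 1 j)) := row0.
    by rewrite !mxE (ord1 i) lshift0 mulr0.
  have ul : ulsubmx M' = l%:M.
    apply/matrixP => i j; have /rowP/(_ 0) := row0.
    by rewrite !mxE !ord1 !lshift0 /= mulr1.
  have dl : dlsubmx M' = 0 by rewrite -M'T -trmx_ursub u0 trmx0.
  exists (drsubmx M'); first by rewrite trmx_drsub M'T.
  by rewrite -[LHS](@submxK _ 1 n 1 n) ul u0 dl.
have [DA DAT HAH] := deflate A a AT cA.
have [DB DBT HBH] := deflate B b BT cB.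
(* Conjugation by the involution [H] preserves commutation, which is then read on the lower right
   blocks. *)
have DAB : DA *m DB = DB *m DA.
  have : block_mx (a%:M : 'M[R]_1) 0 0 DA *m block_mx (b%:M : 'M[R]_1) 0 0 DB =
         block_mx (b%:M : 'M[R]_1) 0 0 DB *m block_mx (a%:M : 'M[R]_1) 0 0 DA.
    rewrite -HAH -HBH !mulmxA -!(mulmxA _ H H) HH !mulmx1.
    by rewrite -(mulmxA H A) -(mulmxA H B) AB.
  rewrite !mulmx_block => /eq_block_mx[_ _ _].
  by rewrite !mulmx0 !add0r.
have [P [da [db [PP DAE DBE]]]] := IHn _ _ DAT DBT DAB.
pose Q : 'M[R]_(1 + n) := block_mx 1%:M 0 0 P.
have QQ : Q *m Q^T = 1%:M.
  rewrite /Q tr_block_mx mulmx_block PP.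
  rewrite !(mulmx0, mul0mx, addr0, add0r, mulmx1, trmx1, trmx0).
  by rewrite -scalar_mx_block.
have QE l d : Q *m diag_mx (row_mx (l%:M : 'M[R]_1) d) *m Q^T =
    block_mx (l%:M : 'M[R]_1) 0 0 (P *m diag_mx d *m P^T).
  rewrite /Q diag_mx_row tr_block_mx !mulmx_block.
  rewrite !(mulmx0, mul0mx, addr0, add0r, mulmx1, mul1mx, trmx1, trmx0).
  by congr block_mx; apply/matrixP => i j; rewrite !mxE !ord1.
have conjE (M : 'M[R]_(1 + n)) (l : R) D d :
    H *m M *m H = block_mx (l%:M : 'M[R]_1) 0 0 D ->
    D = P *m diag_mx d *m P^T ->
    M = (H *m Q) *m diag_mx (row_mx (l%:M : 'M[R]_1) d) *m (H *m Q)^T.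
  move=> HMH DE.
  have -> : M = H *m (H *m M *m H) *m H.
    by rewrite !mulmxA HH mul1mx -mulmxA HH mulmx1.
  by rewrite HMH DE -QE trmx_mul HT !mulmxA.
exists (H *m Q), (row_mx (a%:M : 'M[R]_1) da).
exists (row_mx (b%:M : 'M[R]_1) db); split.
- by rewrite trmx_mul HT mulmxA -(mulmxA H) QQ mulmx1.
- exact: conjE HAH DAE.
- exact: conjE HBH DBE.
Qed.

(** * Entries of [P *m diag_mx d *m P^T] and the linear program *)

Lemma symmetricmxP (R : realType) n (A : 'M[R]_n) :
  reflect (A^T = A) (A \is symmetricmx).
Proof.
rewrite is_hermitianmxE expr0 scale1r map_mx_id //.
by apply: (iffP eqP) => /esym.
Qed.

Lemma conj_diagE (R : comRingType) n (P : 'M[R]_n) (d : 'rV_n) i j :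
  (P *m diag_mx d *m P^T) i j = \sum_k d 0 k * (P i k * P j k).
Proof.
rewrite !mxE; apply: eq_bigr => k _.
by rewrite mul_mx_diag !mxE; ring.
Qed.

(** Together with [conj_diagE], this identifies the matrix constrained by the linear program with
    [P *m diag_mx w *m P^T]. *)
Lemma sum_outer_colE (R : comRingType) n (P : 'M[R]_n) (w : 'I_n -> R) i j :
  (\sum_(k < n) w k *: (col k P *m (col k P)^T)) i j =
  \sum_k w k * (P i k * P j k).
Proof.
rewrite summxE; apply: eq_bigr => k _.
by rewrite !mxE big_ord1 !mxE.
Qed.

(* Attainment of the linear program: for [alpha >= -1] the diagonal
   constraints bound [omega k] from below as soon as column [k] of [P] is
   nonzero, and [omega k] is irrelevant otherwise, so a compact box suffices.
   The sum over (i, j) of [`|x_ij| - x_ij] measures infeasibility at level 0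
   continuously. *)
Lemma alpha_star_ge0P (R : realType) n (P L : 'M[R]_n) :
  (0 <= alpha_star P L)%E <->
  exists2 w : 'rV[R]_n, forall i, w 0 i <= L i i &
    forall i j, 0 <= (P *m diag_mx w *m P^T) i j.
Proof.
split=> [a0|[w wL w0]]; last first.
  apply: ereal_sup_ubound; exists 0 => //; exists (w 0); split=> // i j _.
  by rewrite sum_outer_colE -conj_diagE.
pose f i j (w : 'rV[R]_n) : R := (P *m diag_mx w *m P^T) i j.
have fC i j w : f i j w = f j i w.
  by rewrite /f !conj_diagE; apply: eq_bigr => k _; rewrite (mulrC (P i k)).
(* The constraint at (i, i) and level -1 is solved for [omega k], the other variables being replaced
   by their upper bounds [L l l]. For a zero column the interval shrinks to the point [L k k]. *)
pose lo k : R := if [pick i | P i k != 0] is Some i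
  then (-1 - \sum_(l | l != k) L l l * (P i l * P i l)) / (P i k * P i k)
  else L k k.
(* A nonnegative supremum only provides points feasible at level [- e] for each [e > 0]; compactness
   of the box later replaces them by one point at level 0. *)
have feas (e : R) : 0 < e -> e <= 1 -> exists2 w : 'rV[R]_n,
    forall k, lo k <= w 0 k <= L k k & forall i j, - e <= f i j w.
  move=> e0 e1.
  have : ((- e)%:E < alpha_star P L)%E.
    by apply: lt_le_trans a0; rewrite lte_fin oppr_lt0.
  move=> /ereal_sup_gt[_ [a [w [wL wa] <-]]]; rewrite lte_fin => ea.
  (* The program constrains only [i <= j]; symmetry gives the other entries. *)
  have wP i j : - e <= \sum_k w k * (P i k * P j k).
    have [ij|/ltnW ij] := leqP i j.
      by have := wa i j ij; rewrite sum_outer_colE => /(le_trans (ltW ea)).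
    have := wa j i ij; rewrite sum_outer_colE => /(le_trans (ltW ea)).
    under eq_bigr do rewrite [P j _ * _]mulrC.
    by [].
  (* Resetting the coordinates of zero columns puts the point in the box and leaves the matrix
     unchanged. *)
  pose w' : 'rV[R]_n := \row_k
    if [pick i | P i k != 0] is Some _ then w k else L k k.
  exists w' => [k|i j].
    rewrite mxE /lo; case: pickP => [i Pik|_]; last by rewrite !lexx.
    rewrite wL andbT ler_pdivrMr; last by rewrite -expr2 exprn_even_gt0.
    rewrite lerBlDr; apply: (@le_trans _ _ (- e)); first by rewrite lerN2.
    apply: le_trans (wP i i) _; rewrite (bigD1 k) //= lerD2l ler_sum // => l _.
    by rewrite ler_wpM2r // -expr2 sqr_ge0.
  apply: le_trans (wP i j) _; rewrite /f conj_diagE le_eqVlt; apply/orP; left.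
  apply/eqP/eq_bigr => k _; rewrite mxE; case: pickP => // Pk.
  by have /negbFE/eqP -> := Pk i; rewrite !(mul0r, mulr0).
have fcont i j : continuous (f i j).
  rewrite (_ : f i j = fun w => \sum_k w 0 k * (P i k * P j k)); last first.
    by apply/funext => w; rewrite /f conj_diagE.
  apply: continuous_sum => k x.
  apply: (@continuousM _ _ _ (fun=> P i k * P j k)); last exact: cst_continuous.
  exact: coord_continuous.
pose h w := \sum_i \sum_j (`|f i j w| - f i j w).
have hcont : continuous h.
  apply: continuous_sum => i; apply: continuous_sum => j x.
  apply: (@continuousB _ _ _ (fun w => `|f i j w|)); last exact: fcont.
  by apply: continuous_comp; [exact: fcont|exact: norm_continuous].
have term_ge0 w i j : 0 <= `|f i j w| - f i j w by rewrite subr_ge0 ler_norm.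
pose box := [set w : 'rV[R]_n | forall k, `[lo k, L k k]%classic (w 0 k)].
have [|||w /[!inE] wbox wmin] := @compact_EVT_min _ R h box.
- have [|w wP _] := feas 1 ltr01; first exact: lexx.
  by exists w => k /=; rewrite in_itv /= wP.
- apply: (@rV_compact _ _ (fun k => `[lo k, L k k]%classic)) => k.
  exact: segment_compact.
- exact: continuous_subspaceT.
exists w => [i|i j].
  by have := wbox i; rewrite /= in_itv /= => /andP[].
have hw_le0 : h w <= 0.
  apply/ler_addgt0Pr => /= e e0; rewrite add0r.
  (* At a point feasible at level [- d] each of the [n * n] terms of [h] is at most [2 * d]. The
     added 1 keeps the divisor positive even for [n = 0]. *)
  have [d [d0 d1 dN]] :
      exists d : R, [/\ 0 < d, d <= 1 & d * (2 * ((n * n)%:R + 1)) <= e].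
    have N0 : 0 < 2 * ((n * n)%:R + 1) :> R by rewrite mulr_gt0 // ltr_wpDl.
    exists (Num.min 1 (e / (2 * ((n * n)%:R + 1)))); split.
    - by rewrite lt_min ltr01 divr_gt0.
    - by rewrite ge_min lexx.
    - by rewrite -ler_pdivlMr // ge_min lexx orbT.
  have [v vlo vd] := feas d d0 d1.
  apply: (@le_trans _ _ (h v)).
    by apply: wmin; rewrite inE => k /=; rewrite in_itv /= vlo.
  apply: (@le_trans _ _ (\sum_(i < n) \sum_(j < n) (2 * d))).
    apply: ler_sum => i' _; apply: ler_sum => j' _.
    have := vd i' j'; case: (ger0P (f i' j' v)); lra.
  rewrite !sumr_const card_ord -mulrnA -mulr_natl.
  by nra.
have hw0 : h w == 0.
  by rewrite eq_le hw_le0 sumr_ge0 // => ? _; rewrite sumr_ge0.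
move: hw0; rewrite psumr_eq0; last by move=> ? _; rewrite sumr_ge0.
move=> /allP/(_ i (mem_index_enum i)) /=; rewrite psumr_eq0 //.
move=> /allP/(_ j (mem_index_enum j)) /=; rewrite subr_eq0 => /eqP fE.
by rewrite -/(f i j w) -fE.
Qed.

(** * Algebra of the matrices [P *m diag_mx d *m P^T] *)

Lemma conj_diag_sym (R : comRingType) n (P : 'M[R]_n) (d : 'rV_n) :
  (P *m diag_mx d *m P^T)^T = P *m diag_mx d *m P^T.
Proof. by rewrite !trmx_mul trmxK tr_diag_mx mulmxA. Qed.

Lemma conj_diagD (R : comRingType) n (P : 'M[R]_n) (d e : 'rV_n) :
  P *m diag_mx (d + e) *m P^T = P *m diag_mx d *m P^T + P *m diag_mx e *m P^T.
Proof. by rewrite linearD /= mulmxDr mulmxDl. Qed.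

Lemma conj_diagM (R : comRingType) n (P : 'M[R]_n) (d e : 'rV_n) :
  P^T *m P = 1%:M ->
  (P *m diag_mx d *m P^T) *m (P *m diag_mx e *m P^T) =
  P *m diag_mx (\row_k (d 0 k * e 0 k)) *m P^T.
Proof.
move=> PP; rewrite !mulmxA -[_ *m P^T *m P]mulmxA PP mulmx1.
by rewrite -(mulmxA P) mulmx_diag.
Qed.

(** In the coordinates [P^T *m x] the form is a sum of squares weighted by [d], which ties positive
    semidefiniteness to the signs of [d]. *)
Lemma quad_conj_diag (R : comRingType) n (P : 'M[R]_n) (d : 'rV_n)
    (x : 'cV[R]_n) :
  (x^T *m (P *m diag_mx d *m P^T) *m x) 0 0 =
  \sum_k d 0 k * ((P^T *m x) k 0) ^+ 2.
Proof.
rewrite !mulmxA -mulmxA.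
have -> : x^T *m P = (P^T *m x)^T by rewrite trmx_mul trmxK.
move: (P^T *m x) => y; rewrite mxE; apply: eq_bigr => k _.
by rewrite mul_mx_diag !mxE; ring.
Qed.

Lemma diagonalE (R : nzRingType) n (L : 'M[R]_n) :
  is_diag_mx L -> exists2 d, L = diag_mx d & forall k, d 0 k = L k k.
Proof.
move=> /is_diag_mxP L0; exists (\row_k L k k); last by move=> k; rewrite mxE.
apply/matrixP => i j; rewrite !mxE.
by have [->|/L0] := eqVneq i j; rewrite ?mulr1n ?mulr0n.
Qed.

(** * The two cones, the chain of inclusions and the convex hulls *)

Section ConeTheory.
Context {R : realType} {n : nat}.
Implicit Types (P S N A : 'M[R]_n) (d : 'rV[R]_n).

Lemma psd_conj_diag P d :
  (forall k, 0 <= d 0 k) -> psd_cone R n (P *m diag_mx d *m P^T).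
Proof.
move=> d0; split; first exact/symmetricmxP/conj_diag_sym.
move=> x; rewrite quad_conj_diag sumr_ge0 // => k _.
by rewrite mulr_ge0 ?sqr_ge0.
Qed.

Lemma psd_cone0 : psd_cone R n 0.
Proof.
split; first by apply/symmetricmxP; rewrite trmx0.
by move=> x; rewrite mulmx0 mul0mx mxE.
Qed.

Lemma psd_coneD S N : psd_cone R n S -> psd_cone R n N -> psd_cone R n (S + N).
Proof.
move=> [/symmetricmxP ST S0] [/symmetricmxP NT N0].
split; first by apply/symmetricmxP; rewrite linearD /= ST NT.
by move=> x; rewrite mulmxDr mulmxDl mxE addr_ge0.
Qed.

Lemma psd_coneZ (a : R) S : 0 <= a -> psd_cone R n S -> psd_cone R n (a *: S).
Proof.
move=> a0 [/symmetricmxP ST S0].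
split; first by apply/symmetricmxP; rewrite linearZ /= ST.
by move=> x; rewrite -scalemxAr -scalemxAl mxE mulr_ge0.
Qed.

Lemma nonneg_cone0 : nonneg_cone R n 0.
Proof.
split; first by apply/symmetricmxP; rewrite trmx0.
by move=> i j; rewrite mxE.
Qed.

Lemma nonneg_coneD S N :
  nonneg_cone R n S -> nonneg_cone R n N -> nonneg_cone R n (S + N).
Proof.
move=> [/symmetricmxP ST S0] [/symmetricmxP NT N0].
split; first by apply/symmetricmxP; rewrite linearD /= ST NT.
by move=> i j; rewrite mxE addr_ge0.
Qed.

Lemma nonneg_coneZ (a : R) S :
  0 <= a -> nonneg_cone R n S -> nonneg_cone R n (a *: S).
Proof.
move=> a0 [/symmetricmxP ST S0].
split; first by apply/symmetricmxP; rewrite linearZ /= ST.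
by move=> i j; rewrite mxE mulr_ge0.
Qed.

(** The slack [d] in the bounds [w <= L] is nonnegative and gives the semidefinite part. Stated for
    any square [P], so as to serve both [Gset] and [Ghat]. *)
Lemma alpha_star_decomposition P (L : 'M[R]_n) :
  diagonal_matrices L -> (0 <= alpha_star P L)%E ->
  exists d w, [/\ psd_cone R n (P *m diag_mx d *m P^T),
    nonneg_cone R n (P *m diag_mx w *m P^T) & L = diag_mx (d + w)].
Proof.
move=> /diagonalE[l -> lE] /alpha_star_ge0P[w wl w0].
exists (l - w), w; split; last by rewrite subrK.
- by apply: psd_conj_diag => k; rewrite !mxE subr_ge0 lE wl.
- by split=> //; exact/symmetricmxP/conj_diag_sym.
Qed.

Lemma Gset_com_sum : Gset R n = com_sum R n.
Proof.
apply/seteqP; split=> [A [_ [P [L [PP Ldiag -> a0]]]]|].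
  have [d [w [dP wP ->]]] := alpha_star_decomposition _ _ Ldiag a0.
  have PP' : P^T *m P = 1%:M by exact: mulmx1C.
  exists (P *m diag_mx d *m P^T), (P *m diag_mx w *m P^T); split=> //.
    rewrite !conj_diagM //; congr (_ *m diag_mx _ *m _).
    by apply/rowP => k; rewrite !mxE mulrC.
  exact: conj_diagD.
move=> A [S [N [[/symmetricmxP ST Spos] [/symmetricmxP NT Npos] SN ->]]].
split; first by apply/symmetricmxP; rewrite linearD /= ST NT.
have [P [s [w [PP SE NE]]]] := symmetric_codiagonalizable _ _ _ _ ST NT SN.
have PP' : P^T *m P = 1%:M by exact: mulmx1C.
exists P, (diag_mx (s + w)); split=> //.
- exact: diag_mx_is_diag.
- by rewrite conj_diagD -SE -NE.
apply/alpha_star_ge0P; exists w; last by rewrite -NE.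
move=> k; rewrite !mxE eqxx mulr1n lerDr.
(* The form of [S] at the [k]-th column of [P] is the eigenvalue [s 0 k]. *)
have := Spos (P *m delta_mx k 0); rewrite SE quad_conj_diag mulmxA PP' mul1mx.
rewrite (bigD1 k) //= big1 => [|i ik];
  rewrite !mxE ?eqxx ?expr1n ?mulr1 ?addr0 //.
by rewrite (negPf ik) expr0n mulr0.
Qed.

Lemma Gset_sub_Ghat : Gset R n `<=` Ghat R n.
Proof. by move=> A [AT [P [L [_ Ldiag AE a0]]]]; split=> //; exists P, L. Qed.

Lemma Ghat_sub_sum :
  Ghat R n `<=` minkowski_sum (psd_cone R n) (nonneg_cone R n).
Proof.
move=> A [_ [P [L [Ldiag -> a0]]]].
have [d [w [dP wP ->]]] := alpha_star_decomposition _ _ Ldiag a0.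
rewrite conj_diagD; exists (P *m diag_mx d *m P^T) => //.
by exists (P *m diag_mx w *m P^T).
Qed.

(** The zero matrix lies in both cones and commutes with every matrix. *)
Lemma union_sub_com_sum : psd_cone R n `|` nonneg_cone R n `<=` com_sum R n.
Proof.
move=> A [A0|A0].
  by exists A, 0; rewrite mulmx0 mul0mx addr0; split=> //; exact: nonneg_cone0.
by exists 0, A; rewrite mulmx0 mul0mx add0r; split=> //; exact: psd_cone0.
Qed.

(** The sum of the cones is convex, hence contains the hull; conversely [S + N] is the midpoint of
    [2 *: S] and [2 *: N], which lie in the union. A general [X] covers every hull of the
    theorem. *)
Lemma conv_hull_sandwich (X : set 'M[R]_n) :
  psd_cone R n `|` nonneg_cone R n `<=` X ->
  X `<=` minkowski_sum (psd_cone R n) (nonneg_cone R n) ->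
  conv_hull X = minkowski_sum (psd_cone R n) (nonneg_cone R n).
Proof.
move=> UX XM; apply/seteqP; split.
  apply: smallest_sub => // x y k /[!inE] -[S S0 [N N0 <-]].
  move=> [S' S'0 [N' N'0 <-]].
  have k0 : 0 <= k%:num by [].
  have k1 : 0 <= 1 - k%:num by rewrite subr_ge0.
  exists (k%:num *: S + (1 - k%:num) *: S').
    by apply: psd_coneD; exact: psd_coneZ.
  exists (k%:num *: N + (1 - k%:num) *: N').
    by apply: nonneg_coneD; exact: nonneg_coneZ.
  by rewrite /conv /= !scalerDr addrACA.
move=> _ [S S0 [N N0 <-]] C [Cconv XC].
have h0 : 0 <= (2^-1 : R) by rewrite invr_ge0.
have h1 : (2^-1 : R) <= 1 by lra.
have := Cconv (2 *: S) (2 *: N) (Itv01 h0 h1).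
rewrite !inE.
have -> : conv (Itv01 h0 h1) (2 *: S : convex_lmodType 'M[R]_n) (2 *: N) =
    S + N.
  change (2^-1 *: (2 *: S) + (1 - 2^-1) *: (2 *: N) = S + N).
  rewrite !scalerA (_ : 1 - 2^-1 = 2^-1) ?mulVf ?scale1r //.
  by lra.
by apply; apply: XC; apply: UX;
  [left; exact: psd_coneZ|right; exact: nonneg_coneZ].
Qed.

End ConeTheory.

(** * Matrices of order two *)

(* If [S + N] has a negative off-diagonal entry, then its quadratic form at
   (a, b) has only nonnegative terms when [a * b <= 0] and dominates the form
   of [S] when [a * b >= 0]. *)
Lemma sum_sub_union_2 (R : realType) :
  minkowski_sum (psd_cone R 2) (nonneg_cone R 2) `<=`
  psd_cone R 2 `|` nonneg_cone R 2.
Proof.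
move=> _ [S [/symmetricmxP ST S0] [N [/symmetricmxP NT N0] <-]].
have quadE (M : 'M[R]_2) (x : 'cV[R]_2) : (x^T *m M *m x) 0 0 =
    M 0 0 * x 0 0 ^+ 2 + (M 0 1 + M 1 0) * (x 0 0 * x 1 0) + M 1 1 * x 1 0 ^+ 2.
  rewrite !mxE !big_ord_recl !big_ord0 !mxE !big_ord_recl !big_ord0 !mxE.
  have -> : lift ord0 ord0 = 1 :> 'I_2 by exact: val_inj.
  have -> : ord0 = 0 :> 'I_2 by exact: val_inj.
  by ring.
have AT : (S + N)^T = S + N by rewrite linearD /= ST NT.
have S10 : S 1 0 = S 0 1 by rewrite -[in LHS]ST mxE.
have N10 : N 1 0 = N 0 1 by rewrite -[in LHS]NT mxE.
pose u (a b : R) : 'cV[R]_2 := \col_i if i == 0 then a else b.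
have Su a b : 0 <= S 0 0 * a ^+ 2 + (S 0 1 + S 1 0) * (a * b) + S 1 1 * b ^+ 2.
  by have := S0 (u a b); rewrite quadE !mxE.
have S00 : 0 <= S 0 0 by have := Su 1 0; lra.
have S11 : 0 <= S 1 1 by have := Su 0 1; lra.
(* The diagonal entries of [S + N] are nonnegative in any case, so the sign of the off-diagonal
   entry decides which cone contains the sum. *)
have [A01|A01] := lerP 0 (S 0 1 + N 0 1).
  right; split; first exact/symmetricmxP.
  have cases (i : 'I_2) : i = 0 \/ i = 1.
    by case: i => -[|[|//]] ?; [left|right]; exact: val_inj.
  move=> i j; rewrite mxE; case: (cases i) => ->; case: (cases j) => ->.
  - exact: addr_ge0.
  - exact: A01.
  - by rewrite S10 N10.
  - exact: addr_ge0.
left; split; first exact/symmetricmxP.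
move=> x; rewrite quadE !mxE S10 N10.
have := Su (x 0 0) (x 1 0); rewrite S10.
move: (x 0 0) (x 1 0) => a b Sab.
have aa := sqr_ge0 a; have bb := sqr_ge0 b.
have Naa := mulr_ge0 (N0 0 0) aa; have Nbb := mulr_ge0 (N0 1 1) bb.
have Saa := mulr_ge0 S00 aa; have Sbb := mulr_ge0 S11 bb.
have [ab|/ltW ab] := lerP 0 (a * b).
  by have := mulr_ge0 (N0 0 1) ab; lra.
by have := mulr_le0 (ltW A01) ab; lra.
Qed.

(** * Assembly of the inclusions and hulls *)

Theorem theorem2p3 (R : realType) (n : nat) (hn : (1 <= n)%N) :
  (psd_cone R n `|` nonneg_cone R n `<=` Gset R n) /\
  (Gset R n = com_sum R n) /\
  (conv_hull (psd_cone R n `|` nonneg_cone R n)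
     = minkowski_sum (psd_cone R n) (nonneg_cone R n)) /\
  [/\ psd_cone R n `|` nonneg_cone R n `<=` Gset R n,
      Gset R n = com_sum R n,
      com_sum R n `<=` Ghat R n
    & Ghat R n `<=` minkowski_sum (psd_cone R n) (nonneg_cone R n)] /\
  (n = 2%N ->
    [/\ psd_cone R n `|` nonneg_cone R n = Gset R n,
        Gset R n = com_sum R n,
        com_sum R n = Ghat R n
      & Ghat R n = minkowski_sum (psd_cone R n) (nonneg_cone R n)]) /\
  [/\ conv_hull (psd_cone R n `|` nonneg_cone R n) = conv_hull (Gset R n),
      conv_hull (Gset R n) = conv_hull (com_sum R n),
      conv_hull (com_sum R n) = conv_hull (Ghat R n)
    & conv_hull (Ghat R n)
        = minkowski_sum (psd_cone R n) (nonneg_cone R n)].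
Proof.
have GE := @Gset_com_sum R n.
have UC := @union_sub_com_sum R n.
have CH : com_sum R n `<=` Ghat R n by rewrite -GE; exact: Gset_sub_Ghat.
have HM := @Ghat_sub_sum R n.
have UH := subset_trans UC CH; have CM := subset_trans CH HM.
have hullU := conv_hull_sandwich _ (@subset_refl _ _) (subset_trans UH HM).
have hullC := conv_hull_sandwich _ UC CM.
have hullH := conv_hull_sandwich _ UH HM.
rewrite GE hullU hullC hullH.
split=> //; split=> //; split=> //; split=> //; split=> // n2.
(* In order two the largest set of the chain lies in the smallest, so all inclusions become
   equalities. *)
have MU : minkowski_sum (psd_cone R n) (nonneg_cone R n) `<=`
    psd_cone R n `|` nonneg_cone R n by rewrite n2; exact: sum_sub_union_2.
split=> //; apply/seteqP; split=> //.
- exact: subset_trans CM MU.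
- exact: subset_trans HM (subset_trans MU UC).
- exact: subset_trans MU UH.
Qed.
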